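(* Let $C:f=0$ be a reduced plane curve of degree $d\geq 3$ in $\mathbb{P}^2$, and let $d_1\leq d_2$ be the two smallest degrees in a minimal system of homogeneous generators of the module of Jacobian syzygies $AR(f)$. Then the following hold. (1) The curve $C$ is free if and only if $d_1+d_2=d-1$. (2) The curve $C$ is plus-one generated if and only if $d_1+d_2=d$.
   Context: Let $S=\mathbb{C}[x,y,z]$ with its standard grading, and let $f\in S$ be homogeneous of degree $d$. Put $AR(f)=\{(a,b,c)\in S^3: af_x+bf_y+cf_z=0\}$, a graded $S$-module in which $(a,b,c)$ has degree $k$ when $a,b,c\in S_k$. The curve $C:f=0$ is an $m$-syzygy curve if a minimal set of homogeneous generators of $AR(f)$ has $m$ elements; the degrees $d_1\leq d_2\leq\dots\leq d_m$ of these generators are the exponents of $C$. The curve $C$ is free if $m=2$. It is plus-one generated if it is a 3-syzygy curve ($m=3$) with $d_1+d_2=d$. *)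

(* Defs.v *)
From HB Require Import structures.
From mathcomp Require Import all_boot all_order all_algebra.
From mathcomp Require Import complex mpoly reals.
Set Implicit Arguments.
Unset Strict Implicit.
Unset Printing Implicit Defensive.
Import GRing.Theory.
Local Open Scope ring_scope.

Section JacobianSyzygies.

Variable K : fieldType.
Local Notation S := {mpoly K[3]}.
Implicit Types (f : S) (d m : nat).

(* [f] has no multiple factor, i.e. the plane curve [f = 0] is reduced; in
   particular [f != 0], since [0 = 0 ^+ 2 * 0] and [0] is not a unit. *)
Definition reduced f : Prop :=
  forall g h : S, f = g ^+ 2 * h -> g \is a GRing.unit.

Definition AR f : {pred 'rV[S]_3} :=
  [pred a : 'rV[S]_3 | \sum_(i < 3) a 0 i * f^`M(i) == 0].

(* As usual, 0 is homogeneous of every degree. *)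
Definition homog_triple (k : nat) (a : 'rV[S]_3) : Prop :=
  forall i, a 0 i \is k.-homog.

Definition generates_AR f m (g : 'I_m -> 'rV[S]_3) (A : {set 'I_m}) : Prop :=
  (forall i, i \in A -> g i \in AR f) /\
  (forall a, a \in AR f ->
     exists c : 'I_m -> S, a = \sum_(i in A) c i *: g i).

(* Minimality is with respect to inclusion; it forces the [g i] to be nonzero
   and pairwise distinct. *)
Definition minimal_generators f m (g : 'I_m -> 'rV[S]_3) : Prop :=
  generates_AR f g setT /\
  (forall A : {set 'I_m}, A \proper setT -> ~ generates_AR f g A).

(* [ds] lists in nondecreasing order the degrees of the members of some minimal
   system of homogeneous generators of [AR f]. *)
Definition exponents f (ds : seq nat) : Prop :=
  sorted leq ds /\
  exists g : 'I_(size ds) -> 'rV[S]_3,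
    minimal_generators f g /\
    (forall i : 'I_(size ds), homog_triple (nth 0%N ds i) (g i)).

Definition syzygy_curve m f : Prop :=
  exists2 ds, size ds = m & exponents f ds.

Definition free_curve f : Prop := syzygy_curve 2 f.

(* [d] is meant to be the degree of [f]. *)
Definition plus_one_generated d f : Prop :=
  exists d1 d2 d3, exponents f [:: d1; d2; d3] /\ (d1 + d2 = d)%N.

End JacobianSyzygies.

(* Main.v *)
Require Import Defs.
From HB Require Import structures.
From mathcomp Require Import all_boot all_order all_algebra.
From mathcomp Require Import complex mpoly reals.
From mathcomp Require Import ring.
Set Implicit Arguments.
Unset Strict Implicit.
Unset Printing Implicit Defensive.
Import GRing.Theory.
Local Open Scope ring_scope.
Local Open Scope complex_scope.

(* Write F for the gradient of f. Since f is reduced and the characteristic is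
   zero, no prime divides all partial derivatives (Euler), so for syzygies a, b
   the cross product a x b, which is parallel to F, is h F for a polynomial h.
   For minimal generators of degrees d1, d2 it is nonzero and h is homogeneous of
   degree d1 + d2 - (d - 1). By Cramer's rule h c lies in N = <g1, g2> for every
   syzygy c: if h is constant, g1 and g2 generate; conversely, if two syzygies
   generate, the Koszul syzygies are combinations of them, so h divides F and is
   constant. If h is linear, AR(f) / N is a module over S / h, which is factorial;
   it embeds in the kernel of a nonzero 1 x 2 matrix over S / h, hence is cyclic,
   and graded Nakayama turns one extra generator into one of the given ones. *)

(** * Factorial domains and Gauss's lemma *)

Section Divisibility.

Variable R : idomainType.
Implicit Types (a b c p u v : R).

Definition dvdr a b : Prop := exists c, b = c * a.

Definition prime_elt p : Prop :=
  [/\ p != 0, p \isn't a GRing.unit &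
      forall a b, dvdr p (a * b) -> dvdr p a \/ dvdr p b].

Definition irred_elt p : Prop :=
  [/\ p != 0, p \isn't a GRing.unit &
      forall a b, p = a * b -> a \is a GRing.unit \/ b \is a GRing.unit].

(** Factoring into primes, not irreducibles, makes uniqueness automatic and gives an induction that
    peels off one prime at a time. *)
Inductive prime_product : R -> Prop :=
| PrimeProductUnit u : u \is a GRing.unit -> prime_product u
| PrimeProductMul p c : prime_elt p -> prime_product c -> prime_product (p * c).

Definition factorial : Prop := forall c, c != 0 -> prime_product c.

Lemma dvdr_mull a b c : dvdr a b -> dvdr a (c * b).
Proof. by case=> e ->; exists (c * e); rewrite mulrA. Qed.

Lemma dvdr_mulr a b c : dvdr a b -> dvdr a (b * c).
Proof. by rewrite mulrC; apply: dvdr_mull. Qed.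

Lemma dvdr_add a b c : dvdr a b -> dvdr a c -> dvdr a (b + c).
Proof. by move=> [x ->] [y ->]; exists (x + y); rewrite mulrDl. Qed.

Lemma dvdr_opp a b : dvdr a b -> dvdr a (- b).
Proof. by move=> [x ->]; exists (- x); rewrite mulNr. Qed.

Lemma dvdr_sub a b c : dvdr a b -> dvdr a c -> dvdr a (b - c).
Proof. by move=> ab ac; apply/dvdr_add/dvdr_opp. Qed.

Lemma prime_product_mul a b :
  prime_product a -> prime_product b -> prime_product (a * b).
Proof.
move=> ppa ppb; elim: ppa => [u uu|p c pp _ IH]; last first.
  by rewrite -mulrA; apply: PrimeProductMul.
elim: ppb => [v uv|p c pp _ IH].
  by apply: PrimeProductUnit; rewrite unitrM uu.
by rewrite mulrCA; apply: PrimeProductMul.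
Qed.

Lemma prime_product_neq0 c : prime_product c -> c != 0.
Proof.
elim=> [u|p d [p0 _ _] _ d0]; last by rewrite mulf_neq0.
by apply: contraTneq => ->; rewrite unitr0.
Qed.

(** Irreducibility makes the cofactor of the first prime in the product a unit, so [p] is associate
    to that prime. *)
Lemma irred_prime_product p : irred_elt p -> prime_product p -> prime_elt p.
Proof.
move=> irr pp; case: pp irr => [u uu [_]|]; first by rewrite uu.
move=> q c [q0 qNu qP] _ [p0 pNu pirr].
have uc : c \is a GRing.unit.
  by case: (pirr q c erefl) => //; rewrite (negbTE qNu).
split=> // a b [e].
have dvdqc x : dvdr q x -> dvdr (q * c) x.
  move=> [y ->]; exists (y * c^-1).
  by rewrite [q * c]mulrC mulrA divrK.
move=> E; case: (qP a b); first by exists (e * c); rewrite E mulrAC mulrA.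
  by move/dvdqc; left.
by move/dvdqc; right.
Qed.

Hypothesis factR : factorial.

(** A gcd [g] with coprime cofactors, coprimality being stated through the relations between [u']
    and [v']. Each prime of [u] goes into [g] if it divides what is left of [v], and stays in [u']
    otherwise. *)
Lemma coprime_cofactors u v : u != 0 ->
  exists g u' v', [/\ u = g * u', v = g * v' &
    forall a b, a * u' = b * v' -> exists t, a = t * v' /\ b = t * u'].
Proof.
move=> /factR ppu; elim: ppu v => [w uw|p c [p0 _ pP] _ IH] v.
  exists 1, w, v; rewrite !mul1r; split=> // a b E.
  exists (b / w); rewrite divrK //; split=> //.
  by rewrite mulrAC -E mulrK.
have [[w vE]|Nv] := boolp.pselect (dvdr p v).
  have [g [c' [w' [cE wE gP]]]] := IH w.
  exists (p * g), c', w'; split=> //; first by rewrite cE mulrA.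
  by rewrite vE wE; ring.
have [g [c' [v' [cE vE gP]]]] := IH v.
exists g, (p * c'), v'; split=> //; first by rewrite cE; ring.
move=> a b; rewrite mulrA => /gP [t [apE bE]].
case: (pP t v'); first by exists a.
  move=> [s sE]; exists s; split; last by rewrite bE sE mulrA.
  by apply: (mulIf p0); rewrite apE sE; ring.
move=> [s sE]; case: Nv; exists (g * s); rewrite vE sE; ring.
Qed.

(** Each prime of [c] fails to divide some [v i], so it must divide the part of [w] not yet used
    up. *)
Lemma dvdr_of_no_common_prime (I : Type) (v : I -> R) c w :
    (forall p, prime_elt p -> ~ forall i, dvdr p (v i)) ->
  c != 0 -> (forall i, dvdr c (w * v i)) -> dvdr c w.
Proof.
move=> vP /factR ppc; elim: ppc w => [u uu w _|p {}c pp ppc IH w H].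
  by exists (w / u); rewrite divrK.
have c0 := prime_product_neq0 ppc.
have [i|w1 wE] := IH w.
  by have [e ->] := H i; exists (e * p); rewrite mulrA.
suff [w2 w2E] : dvdr p w1 by exists w2; rewrite wE w2E; ring.
apply: boolp.contrapT => Nw1; apply: (vP p pp) => i.
have [e E] := H i; have [_ _ /(_ w1 (v i))[]//] := pp.
exists e; apply: (mulIf c0); rewrite mulrAC -wE E; ring.
Qed.

End Divisibility.

Section Gauss.

Variable R : idomainType.
Implicit Types (c : R) (p q : {poly R}).

Lemma prime_polyC c : prime_elt c -> prime_elt c%:P.
Proof.
move=> [c0 cNu cP]; split; first by rewrite polyC_eq0.
  by apply: contra cNu; rewrite poly_unitE coefC eqxx => /andP[].
have dvdC q : (forall i, dvdr c q`_i) -> dvdr c%:P q.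
  move=> /boolp.choice[e eE].
  exists (\poly_(i < size q) e i); apply/polyP => i.
  rewrite coefMC coef_poly; case: ltnP => [_|/leq_sizeP-> //].
    exact: eE.
  by rewrite mul0r.
move=> a b [e E].
apply: boolp.contrapT => /boolp.not_orP[Na Nb].
have exN q : ~ dvdr c%:P q -> exists i, ~ dvdr c q`_i.
  by move=> Nq; apply: boolp.contrapT => H; apply/Nq/dvdC => i;
    apply: boolp.contrapT => Ni; apply: H; exists i.
have minN q : ~ dvdr c%:P q -> 
    exists i, ~ dvdr c q`_i /\ forall j, (j < i)%N -> dvdr c q`_j.
  move=> Nq; have [k] := exN q Nq; elim/ltn_ind: k => i IH Ni.
  have [[j [ji Nj]]|H] := boolp.pselect (exists j, (j < i)%N /\ ~ dvdr c q`_j).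
    exact: IH ji Nj.
  exists i; split=> // j ji; apply: boolp.contrapT => Nj; apply: H.
  by exists j.
(* Take the lowest coefficients of [a] and [b] not divisible by [c]. In the coefficient of index
   [i + j] every other term has a factor of lower index, so [c] would divide their product. *)
have [i [Ni ltiP]] := minN _ Na; have [j [Nj ltjP]] := minN _ Nb.
have : dvdr c (a * b)`_(i + j) by rewrite E coefMC; exists e`_(i + j).
have ltij : (i < (i + j).+1)%N by rewrite ltnS leq_addr.
rewrite coefM (bigD1 (Ordinal ltij)) //= addKn => H.
case: (cP a`_i b`_j) => //.
rewrite -[X in dvdr c X](addrK (\sum_(k < (i + j).+1 | k != Ordinal ltij)
                                   a`_k * b`_(i + j - k))).
apply: dvdr_sub H _; elim/big_ind: _ => [|x y|k]; first by exists 0; rewrite mul0r.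
  exact: dvdr_add.
rewrite -val_eqE /= neq_ltn => /orP[ki|ik]; first exact/dvdr_mulr/ltiP.
apply/dvdr_mull/ltjP; rewrite ltn_subLR; first by rewrite ltn_add2r.
by rewrite -ltnS ltn_ord.
Qed.

(** A prime constant cannot divide [p], which is irreducible of positive degree, so it divides the
    cofactor and cancels. *)
Lemma irred_dvd_polyC_cancel p a c : irred_elt p -> (1 < size p)%N ->
  prime_product c -> dvdr p (c%:P * a) -> dvdr p a.
Proof.
move=> [p0 pNu pirr] p1 ppc; elim: ppc a => [u uu|c' {}c pp _ IH] a.
  move=> [e E]; exists (u^-1%:P * e).
  by rewrite -mulrA -E mulrA -polyCM mulVr // mul1r.
rewrite polyCM -mulrA => -[s E].
have [c0 cNu cP] := prime_polyC pp.
have [|[t sE]|[t pE]] := cP s p; first by exists (c%:P * a); rewrite -E mulrC.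
  by apply: IH; exists t; apply: (mulfI c0); rewrite E sE; ring.
have [|] := pirr _ _ pE; last by rewrite (negbTE cNu).
rewrite poly_unitE => /andP[/eqP t1 _]; move: p1.
by rewrite pE mulrC mul_polyC ltnNge (leq_trans (size_scale_leq _ _)) ?t1.
Qed.

(** Every prime of [c] stays prime in [{poly R}], hence divides [q] or [m] and can be removed from
    it. *)
Lemma polyC_mul_split p q m c : prime_product c -> c%:P * p = q * m ->
  exists c1 c2 q1 m1, [/\ q = c1%:P * q1, m = c2%:P * m1 & p = q1 * m1].
Proof.
move=> ppc; elim: ppc q m => [u uu|c' {}c pp _ IH] q m.
  move=> E; exists u, 1, (u^-1%:P * q), m; split; last 1 first.
  - by rewrite -mulrA -E mulrA -polyCM mulVr // mul1r.
  - by rewrite mulrA -polyCM mulrV // mul1r.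
  - by rewrite mul1r.
have [c0 _ cP] := prime_polyC pp.
rewrite polyCM -mulrA => E.
have [|[t qE]|[t mE]] := cP q m.
- by exists (c%:P * p); rewrite -E mulrC.
- have [|c1 [c2 [q1 [m1 [tE -> ->]]]]] := IH t m.
    by apply: (mulfI c0); rewrite E qE; ring.
  by exists (c' * c1), c2, q1, m1; split=> //; rewrite qE tE polyCM; ring.
have [|c1 [c2 [q1 [m1 [-> tE ->]]]]] := IH q t.
  by apply: (mulfI c0); rewrite E mE; ring.
by exists c1, (c' * c2), q1, m1; split=> //; rewrite mE tE polyCM; ring.
Qed.

(** Descent on the size of a nonzero combination: a nonzero remainder of a pseudo-division by it is
    a smaller combination. The constants are powers of its leading coefficient. *)
Lemma pseudo_gcd p a : p != 0 ->
  exists u v c c', [/\ c != 0, c' != 0, dvdr (u * p + v * a) (c%:P * p)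
    & dvdr (u * p + v * a) (c'%:P * a)].
Proof.
move=> p0; have [u [v]] : exists u v, u * p + v * a != 0.
  by exists 1, 0; rewrite mul1r mul0r addr0.
have [n] := ubnP (size (u * p + v * a)).
elim: n u v => // n IH u v; set m := u * p + v * a => /ltnSE mn m0.
have modP q : exists2 c, c != 0 &
    exists e, c%:P * q = e * m + (q %% m)%R.
  exists (lead_coef m ^+ scalp q m); first by rewrite expf_neq0 // lead_coef_eq0.
  by exists (q %/ m); rewrite mul_polyC Pdiv.Idomain.divp_eq.
have [c c0 [e pE]] := modP p; have [c' c'0 [e' aE]] := modP a.
have [rp0|rp0] := eqVneq (p %% m) 0; last first.
  have rE : (c%:P - e * u) * p + - (e * v) * a = p %% m.
    by rewrite -[RHS](addKr (e * m)) -pE /m; ring.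
  by apply: (IH (c%:P - e * u) (- (e * v))); rewrite rE // (leq_trans _ mn) //
    Pdiv.Idomain.ltn_modp.
have [ra0|ra0] := eqVneq (a %% m) 0; last first.
  have rE : - (e' * u) * p + (c'%:P - e' * v) * a = a %% m.
    by rewrite -[RHS](addKr (e' * m)) -aE /m; ring.
  by apply: (IH (- (e' * u)) (c'%:P - e' * v)); rewrite rE // (leq_trans _ mn) //
    Pdiv.Idomain.ltn_modp.
exists u, v, c, c'; split=> //; first by exists e; rewrite pE rp0 addr0.
by exists e'; rewrite aE ra0 addr0.
Qed.

(* Gauss's lemma without the fraction field: a least-degree element of the ideal
   (p, a) divides p and a up to constants, and primes of [R] stay prime in
   [{poly R}], so these constants can be cancelled. *)
Lemma irred_poly_prime p : factorial R -> irred_elt p -> (1 < size p)%N ->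
  prime_elt p.
Proof.
move=> factR pirr p1; have [p0 pNu pP] := pirr; split=> // a b pab.
have [|Npa] := boolp.pselect (dvdr p a); [by left | right].
have [u [v [c [c' [c0 c'0 [q qE] [q' q'E]]]]]] := pseudo_gcd a p0.
have [c1 [c2 [q1 [m1 [_ mE pE]]]]] := polyC_mul_split (factR _ c0) qE.
(* If [q1] is a unit, [p] divides [a] up to a constant, which is excluded. If [m1] is a unit, the
   combination of [p] and [a] is a constant up to a unit; multiplying it by [b] shows that [p]
   divides [b] up to a constant. *)
case: (pP _ _ pE) => [uq1|um1].
  case: Npa; apply: irred_dvd_polyC_cancel (factR _ c'0) _ => //.
  exists (q' * c2%:P * q1^-1); rewrite q'E mE pE.
  by rewrite -!mulrA mulKr.
have c20 : c2 != 0.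
  apply/eqP => c2E; move/eqP: qE; rewrite mE c2E mul0r mulr0.
  by rewrite mulf_eq0 polyC_eq0 (negbTE c0) (negbTE p0).
apply: (irred_dvd_polyC_cancel pirr p1 (factR _ c20)).
have -> : c2%:P = (u * p + v * a) * m1^-1 by rewrite mE mulrK.
have [s abE] := pab; exists ((u * b + v * s) * m1^-1).
by rewrite mulrAC mulrDl -(mulrA v) abE; ring.
Qed.

End Gauss.

(** * Unique factorization in polynomial rings over a field *)

Section MpolyFactorial.

Variable K : fieldType.

(** The inverse of [muni] widens the coefficients and evaluates at the last variable. *)
Lemma muni_bij n (A := {mpoly K[n.+1]}) (B := {poly {mpoly K[n]}}) :
  exists f : {rmorphism A -> B}, exists g : {rmorphism B -> A},
    cancel f g /\ cancel g f.
Proof.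
pose f : {rmorphism A -> B} := @muni n K.
pose g : {rmorphism B -> A} := horner_eval ('X_ord_max : A) \o map_poly (@mwiden n K).
have fw (q : {mpoly K[n]}) : muni (mwiden q) = q%:P.
  elim/mpolyind: q => [|c m q _ _ IH].
    by rewrite mwiden0 muni0.
  rewrite mwidenD mwidenZ mwidenX muniD muniZ IH polyCD; congr (_ + _).
  rewrite muniE msuppX big_seq1 mcoeffX eqxx scale1r mnmwiden_ordmax expr0.
  rewrite -!mul_polyC mulr1 -polyCM mul_mpolyC; congr ((_ *: 'X_[_])%:P).
  by apply/mnmP => i; rewrite mnmE mnmwiden_widen.
have fX : muni 'X_ord_max = 'X :> B.
  rewrite muniE msuppX big_seq1 mcoeffX eqxx scale1r mnmE eqxx expr1.
  suff -> : [multinom (U_(ord_max) (widen_ord (leqnSn n) i))%MM | i < n] = 0%MM.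
    by rewrite mpolyX0 scale1r.
  apply/mnmP => i; rewrite !mnmE -val_eqE /= eqn_leq.
  by rewrite [(n <= i)%N]leqNgt ltn_ord.
have gX : g 'X = 'X_ord_max by rewrite /g /= map_polyX horner_evalE hornerX.
have gC q : g q%:P = mwiden q by rewrite /g /= map_polyC horner_evalE hornerC.
have fK p : g (muni p) = p.
  elim/mpolyind: p => [|c m p _ _ IH]; first by rewrite muni0 (rmorph0 g).
  rewrite muniD (rmorphD g); congr (_ + _); last exact: IH.
  rewrite muniZ -mul_polyC (rmorphM g) gC mwidenC.
  rewrite muniE msuppX big_seq1 mcoeffX eqxx scale1r -mul_polyC.
  rewrite (rmorphM g) (rmorphXn g) gX gC mwidenX -mul_mpolyC; congr (_ * _).
  rewrite (mpolyXE_id K m) (mpolyXE_id K (mnmwiden _)) [RHS]big_ord_recr [X in X * _]big_ord_recr /=.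
  rewrite mnmwiden_ordmax expr0 mulr1; congr (_ * _).
  by apply: eq_bigr => i _; rewrite mnmwiden_widen mnmE.
have gK q : muni (g q) = q.
  elim/poly_ind: q => [|q c IH]; first by rewrite (rmorph0 g) muni0.
  by rewrite (rmorphD g) (rmorphM g) muniD muniM IH gX gC fX fw.
by exists f, g; split.
Qed.

Lemma mpoly_unitP n (p : {mpoly K[n]}) :
  reflect (exists2 c, c != 0 & p = c%:MP) (p \is a GRing.unit).
Proof.
apply: (iffP andP) => [[/eqP pE u]|[c c0 ->]].
  by exists p@_0%MM => //; rewrite -unitfE.
by rewrite mpolyCK unitfE.
Qed.

(** Induction on the size: over a field nonunits are nonconstant, so both factors of a proper
    splitting are smaller. *)
Lemma mpoly_factorial_of_irred n :
    (forall p : {mpoly K[n]}, irred_elt p -> prime_elt p) ->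
  factorial {mpoly K[n]}.
Proof.
move=> irrP d; have [k] := ubnP (msize d).
elim: k d => // k IH c /ltnSE ck c0.
have [cu|cNu] := boolP (c \is a GRing.unit); first exact: PrimeProductUnit.
have [irrc|Nirr] := boolp.pselect (irred_elt c).
  by rewrite -[c]mulr1; apply/PrimeProductMul/PrimeProductUnit/unitr1/irrP.
have [a [b [cE /negP aNu /negP bNu]]] : exists a b, [/\ c = a * b,
    ~ (a \is a GRing.unit) & ~ (b \is a GRing.unit)].
  apply: boolp.contrapT => H; apply: Nirr; split=> // a b cE.
  apply: boolp.contrapT => /boolp.not_orP[aNu bNu]; apply: H.
  by exists a, b.
move: c0; rewrite cE mulf_eq0 negb_or => /andP[a0 b0].
have sz1 (p : {mpoly K[n]}) : p != 0 -> p \isn't a GRing.unit -> (1 < msize p)%N.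
  move=> p0 pNu; rewrite ltnNge; apply: contra pNu => /msize1_polyC pE.
  apply/mpoly_unitP; exists p@_0%MM => //.
  by apply: contraNneq p0 => e; rewrite pE e.
move: (sz1 a a0 aNu) (sz1 b b0 bNu) => a1 b1.
have szc : ((msize a + msize b).-1 <= k)%N by rewrite -msizeM // -cE.
apply: prime_product_mul; apply: IH => //; apply: leq_trans szc.
  by rewrite -(prednK (ltnW b1)) addnS /= -addn1 leq_add2l -ltnS prednK ?(ltnW b1).
by rewrite -(prednK (ltnW a1)) addSn /= -add1n leq_add2r -ltnS prednK ?(ltnW a1).
Qed.

Theorem mpoly_factorial n : factorial {mpoly K[n]}.
Proof.
elim: n => [|n IH].
  move=> c c0; apply/PrimeProductUnit/mpoly_unitP; exists c@_0%MM.
    by apply: contraNneq c0 => e; rewrite [c]nvar0_mpolyC e.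
  exact: nvar0_mpolyC.
apply: mpoly_factorial_of_irred => p [p0 pNu pirr].
have [f [g [fK gK]]] := muni_bij n.
have irrfp : irred_elt (f p).
  split.
  - by rewrite -(rmorph0 f) (can_eq fK).
  - by apply: contra pNu => /(rmorph_unit g); rewrite fK.
  move=> a b fpE; have [] := pirr (g a) (g b).
  - by rewrite -rmorphM -fpE fK.
  - by move=> /(rmorph_unit f); rewrite gK; left.
  - by move=> /(rmorph_unit f); rewrite gK; right.
have [fp0 fpNu fpP] : prime_elt (f p).
  have [p1|p1] := ltnP 1 (size (f p)); first exact: irred_poly_prime.
  (* When the last variable does not occur, a factorization in the coefficient ring carries over by
     [prime_polyC]. *)
  have [e fpC] : exists e, f p = e%:P by exists (f p)`_0; apply: size1_polyC.
  apply: (irred_prime_product irrfp).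
  have : e != 0 by case: irrfp => + _ _; rewrite fpC polyC_eq0.
  rewrite fpC; move=> /IH; elim=> [u uu|q c pq _ IHc].
    exact/PrimeProductUnit/(rmorph_unit polyC).
  by rewrite polyCM; apply: PrimeProductMul => //; apply: prime_polyC.
split=> // a b [c E].
have back x : dvdr (f p) (f x) -> dvdr p x.
  by move=> [y e]; exists (g y); rewrite -[x]fK e rmorphM fK.
have [|/back|/back] := fpP (f a) (f b); [|by left|by right].
by exists (f c); rewrite -!rmorphM E.
Qed.

End MpolyFactorial.

(** * Homogeneous polynomials *)

Section Homogeneous.

Variables (K : fieldType) (n : nat).
Local Notation S := {mpoly K[n]}.
Implicit Types (p q f h : S).

Lemma msupp_gradient f m i : m \in msupp f^`M(i) -> (m + U_(i))%MM \in msupp f.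
Proof.
rewrite !mcoeff_msupp mcoeff_mderiv; apply: contra => /eqP ->.
by rewrite mul0rn.
Qed.

Lemma mderiv_dhomog d f i : f \is d.+1.-homog -> f^`M(i) \is d.-homog.
Proof.
move=> /dhomogP fd; apply/dhomogP => m /msupp_gradient /fd /=.
by rewrite mdegD mdeg1 addn1 => -[].
Qed.

Lemma euler_identity d f : f \is d.-homog -> \sum_i 'X_i * f^`M(i) = d%:R *: f.
Proof.
move=> /dhomogP fd.
have E i : 'X_i * f^`M(i) = \sum_(m <- msupp f) (m i)%:R *: (f@_m *: 'X_[m]).
  rewrite {1}[f]mpolyE linear_sum mulr_sumr; apply: eq_bigr => m _ /=.
  rewrite mderivZ mderivX -!scalerAr !scalerA mulrC.
  have [->|mi] := posnP (m i); first by rewrite !mul0r !scale0r.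
  congr (_ *: _); rewrite -mpolyXD; congr 'X_[_].
  by rewrite addmC submK // lep1mP -lt0n.
rewrite (eq_bigr _ (fun i _ => E i)) exchange_big /= [X in _ = _ *: X]mpolyE scaler_sumr.
rewrite big_seq [RHS]big_seq; apply: eq_bigr => m /fd <-.
by rewrite -scaler_suml -natr_sum -mdegE.
Qed.

Lemma msize_mderiv p i : p^`M(i) != 0 -> (msize p^`M(i) < msize p)%N.
Proof.
move=> pi0; rewrite -mlead_deg //.
have /msupp_gradient/msize_mdeg_lt := mlead_supp pi0.
by rewrite mdegD mdeg1 addn1.
Qed.

Hypothesis charK : [pchar K] =i pred0.

(** Differentiate along a variable of the leading monomial: in characteristic zero the result is
    nonzero, and it is too small to be a multiple of [p]. *)
Lemma prime_not_dvd_gradient p : prime_elt p -> exists i, ~ dvdr p p^`M(i).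
Proof.
move=> [p0 pNu _]; have [i lpi] : exists i, (0 < mlead p i)%N.
  apply: boolp.contrapT => H; case/negP: pNu; apply/mpoly_unitP.
  apply/msize_poly1P; rewrite -mlead_deg // mdegE big1 // => i _.
  by apply/eqP; rewrite -leqn0 leqNgt; apply/negP => lpi; apply: H; exists i.
exists i => -[q E].
have pi0 : p^`M(i) != 0.
  apply/eqP => /(congr1 (mcoeff (mlead p - U_(i))%MM)).
  rewrite mcoeff_mderiv mcoeff0 submK ?lep1mP -?lt0n //.
  by move/eqP; rewrite -mulr_natr mulf_eq0 mleadc_eq0 (negbTE p0) ((pcharf0P K).1 charK).
have q0 : q != 0 by apply: contraNneq pi0 => q0; rewrite E q0 mul0r.
have := msize_mderiv pi0; rewrite E msizeM // ltnNge => /negP[].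
have : (0 < msize q)%N by rewrite lt0n msize_poly_eq0.
by case: (msize q) => // k _; rewrite addSn leq_addl.
Qed.

Theorem reduced_gradient d f : f \is d.+1.-homog ->
    (forall g h, f = g ^+ 2 * h -> g \is a GRing.unit) ->
  forall p, prime_elt p -> ~ forall i, dvdr p f^`M(i).
Proof.
move=> fd fred p pp pdvd; have [p0 pNu pP] := pp.
have [s fE] : dvdr p f.
  have -> : f = (d.+1%:R)^-1 *: \sum_i 'X_i * f^`M(i).
    rewrite (euler_identity fd) scalerA mulVf ?scale1r //.
    by rewrite ((pcharf0P K).1 charK).
  rewrite -mul_mpolyC; apply/dvdr_mull.
  elim/big_ind: _ => [|x y|i _]; [by exists 0; rewrite mul0r|exact: dvdr_add|].
  exact/dvdr_mull/pdvd.
have [i Npi] := prime_not_dvd_gradient pp.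
have : dvdr p (s * p^`M(i)).
  have -> : s * p^`M(i) = f^`M(i) - s^`M(i) * p by rewrite fE mderivM; ring.
  by apply: dvdr_sub (pdvd i) _; exists s^`M(i).
case/pP => // -[t sE]; case/negP: pNu; apply: (fred _ t).
by rewrite fE sE; ring.
Qed.

(** Used to read off one degree of a linear relation. The test [e <= D] guards against the truncated
    subtraction. *)
Lemma pihomogM D e p q : q \is e.-homog ->
  pihomog mdeg D (p * q) =
    (if (e <= D)%N then pihomog mdeg (D - e) p else 0) * q.
Proof.
move=> qe; have pE := pihomog_partitionE (leqnn (msize p)).
have comp i D' : pihomog mdeg D' (pihomog mdeg i p * q) =
    if (i + e == D')%N then pihomog mdeg i p * q else 0.
  have H : pihomog mdeg i p * q \is (i + e).-homog by apply/dhomogM/qe/pihomogP.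
  case: eqP => [<-|/eqP ne]; first exact: pihomog_dE.
  exact: pihomog_ne0 ne H.
rewrite {1}pE mulr_suml linear_sum /=.
under eq_bigr do rewrite comp.
case: leqP => [eD|De]; last first.
  rewrite mul0r big1 // => i _; case: eqP => // iE.
  by rewrite -iE ltnNge leq_addl in De.
rewrite [X in _ = pihomog _ _ X * _]pE linear_sum /= mulr_suml; apply: eq_bigr => i _.
have -> : (i + e == D)%N = (val i == D - e)%N by rewrite -{1}(subnK eD) eqn_add2r.
case: eqP => [<-|/eqP ne]; first by rewrite pihomog_id.
by rewrite (pihomog_ne0 ne (pihomogP _ _ _)) mul0r.
Qed.

Lemma pihomog0E p : pihomog mdeg 0 p = (p@_0%MM)%:MP.
Proof.
apply/mpolyP => m; rewrite mcoeffC; have [->|m0] := eqVneq m 0%MM.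
  rewrite mulr1 [in RHS](pihomog_partitionE (leqnSn (msize p))) [RHS]linear_sum.
  rewrite (bigD1 ord0) //= big1 ?addr0 // => i i0.
  by rewrite (dhomog_nemf_coeff (pihomogP _ i p)) //= mdeg0 eq_sym.
rewrite mulr0 (dhomog_nemf_coeff (pihomogP _ 0%N p)) //=.
by rewrite mdeg_eq0.
Qed.

(** [phi] solves [h = 0] for a variable with nonzero coefficient. Its kernel is the ideal of [h], so
    its image is a copy of the quotient inside [S]. *)
Lemma linear_form_quotient h : h \is 1.-homog -> h != 0 ->
  exists phi : {rmorphism S -> S}, phi h = 0 /\ forall p, dvdr h (p - phi p).
Proof.
move=> h1 h0.
have hE : h = \sum_i h@_U_(i) *: 'X_i.
  apply/mpolyP => m; rewrite linear_sum /=.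
  under eq_bigr do rewrite linearZ /= mcoeffX.
  have [m1|m1] := eqVneq (mdeg m) 1%N; last first.
    rewrite (dhomog_nemf_coeff h1) // big1 // => i _.
    case: eqP => [mE|_]; last by rewrite mulr0.
    by rewrite -mE mdeg1 eqxx in m1.
  have /mdeg1P[j /eqP ->] : mdeg m == 1%N by rewrite m1.
  rewrite (bigD1 j) //= eqxx mulr1 big1 ?addr0 // => i ij.
  by rewrite eq_mnm1 (negbTE ij) mulr0.
have [i hi] : exists i, h@_U_(i) != 0.
  apply: boolp.contrapT => H; case/eqP: h0; rewrite hE big1 // => i _.
  have [->|hi] := eqVneq h@_U_(i) 0; first by rewrite scale0r.
  by case: H; exists i.
pose t := [tuple 'X_j - (if j == i then (h@_U_(i))^-1 *: h else 0) | j < n].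
pose phi : {rmorphism S -> S} := comp_mpoly t.
have phiX j : phi 'X_j = 'X_j - (if j == i then (h@_U_(i))^-1 *: h else 0).
  by rewrite /phi /= comp_mpolyXU -tnth_nth tnth_mktuple.
have phiZ c p : phi (c *: p) = c *: phi p by exact: comp_mpolyZ.
exists phi; split.
  rewrite {1}hE rmorph_sum /=.
  under eq_bigr do rewrite comp_mpolyZ -/(phi _) phiX scalerBr.
  rewrite sumrB -hE (bigD1 i) //= eqxx scalerA mulfV // scale1r.
  rewrite big1 ?addr0 ?subrr // => j /negbTE ->; exact: scaler0.
move=> p; elim/mpolyind: p => [|c m p _ _ IH].
  by rewrite rmorph0 subrr; exists 0; rewrite mul0r.
have -> : c *: 'X_[m] + p - phi (c *: 'X_[m] + p) =
    c%:MP * ('X_[m] - phi 'X_[m]) + (p - phi p).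
  by rewrite rmorphD phiZ -!mul_mpolyC; ring.
apply: dvdr_add IH; apply: dvdr_mull; rewrite mpolyXE_id rmorph_prod /=.
have step a b a' b' : dvdr h (a - a') -> dvdr h (b - b') -> dvdr h (a * b - a' * b').
  have -> : a * b - a' * b' = (a - a') * b + a' * (b - b') by ring.
  by move=> ? ?; apply: dvdr_add; [apply: dvdr_mulr | apply: dvdr_mull].
have d0 : dvdr h 0 by exists 0; rewrite mul0r.
elim/big_ind2: _ => [|? ? ? ?|j _]; [by rewrite subrr| exact: step|].
elim: (m j) => [|k IHk]; first by rewrite rmorph1 subrr.
rewrite !exprS rmorphM; apply: step IHk.
rewrite -/(phi _) phiX opprB addrC subrK; case: eqP => // _.
by rewrite -mul_mpolyC; apply: dvdr_mull; exists 1; rewrite mul1r.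
Qed.

End Homogeneous.

(** * Cross products and graded generators *)

Section CrossProduct.

Lemma ord3P (P : 'I_3 -> Prop) : P 0 -> P 1 -> P (1 + 1) -> forall i, P i.
Proof.
move=> P0 P1 P2 [[|[|[|//]]] lti].
- by rewrite (_ : Ordinal lti = 0) //; apply: val_inj.
- by rewrite (_ : Ordinal lti = 1) //; apply: val_inj.
- by rewrite (_ : Ordinal lti = 1 + 1) //; apply: val_inj.
Qed.

Variable R : comNzRingType.
Implicit Types (a b c F : 'rV[R]_3) (x y z : R).

Definition dot a b : R := \sum_(i < 3) a 0 i * b 0 i.

(** Indices are added in ['I_3], hence wrap around, and one formula serves all coordinates. *)
Definition cross a b : 'rV[R]_3 :=
  \row_l (a 0 (l + 1) * b 0 (l + 1 + 1) - a 0 (l + 1 + 1) * b 0 (l + 1)).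

Lemma dotE a b :
  dot a b = a 0 0 * b 0 0 + a 0 1 * b 0 1 + a 0 (1 + 1) * b 0 (1 + 1).
Proof.
rewrite /dot !big_ord_recl big_ord0 addr0 addrA.
by congr (_ * _ + _ * _ + _ * _); congr (_ _ _); apply: val_inj.
Qed.

Lemma crossE0 a b : cross a b 0 0 = a 0 1 * b 0 (1 + 1) - a 0 (1 + 1) * b 0 1.
Proof. by rewrite mxE add0r. Qed.

Let three0 : 1 + 1 + 1 = 0 :> 'I_3. Proof. exact: val_inj. Qed.

Lemma crossE1 a b : cross a b 0 1 = a 0 (1 + 1) * b 0 0 - a 0 0 * b 0 (1 + 1).
Proof. by rewrite mxE three0. Qed.

Lemma crossE2 a b : cross a b 0 (1 + 1) = a 0 0 * b 0 1 - a 0 1 * b 0 0.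
Proof. by rewrite mxE three0 add0r. Qed.

Definition crossE := (crossE0, crossE1, crossE2).

Lemma cross_minor a b i j : a 0 i * b 0 j - a 0 j * b 0 i = 0 \/
  exists k, a 0 i * b 0 j - a 0 j * b 0 i = cross a b 0 k \/
            a 0 i * b 0 j - a 0 j * b 0 i = - cross a b 0 k.
Proof.
move: i j; apply: ord3P; apply: ord3P; try (by left; ring); right.
- by exists (1 + 1); left; rewrite crossE.
- by exists 1; right; rewrite crossE; ring.
- by exists (1 + 1); right; rewrite crossE; ring.
- by exists 0; left; rewrite crossE.
- by exists 1; left; rewrite crossE.
- by exists 0; right; rewrite crossE; ring.
Qed.

(** The differences are the coordinates of the triple product of [a], [b], [F], which expands as
    [dot a F *: b - dot b F *: a]. *)
Lemma cross_orthogonal a b F : dot a F = 0 -> dot b F = 0 ->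
  forall i j, cross a b 0 i * F 0 j = cross a b 0 j * F 0 i.
Proof.
move=> aF bF.
have E01 : cross a b 0 0 * F 0 1 = cross a b 0 1 * F 0 0.
  apply/subr0_eq; transitivity (b 0 (1 + 1) * dot a F - a 0 (1 + 1) * dot b F).
    by rewrite !dotE !crossE; ring.
  by rewrite aF bF !mulr0 subr0.
have E12 : cross a b 0 1 * F 0 (1 + 1) = cross a b 0 (1 + 1) * F 0 1.
  apply/subr0_eq; transitivity (b 0 0 * dot a F - a 0 0 * dot b F).
    by rewrite !dotE !crossE; ring.
  by rewrite aF bF !mulr0 subr0.
have E20 : cross a b 0 (1 + 1) * F 0 0 = cross a b 0 0 * F 0 (1 + 1).
  apply/subr0_eq; transitivity (b 0 1 * dot a F - a 0 1 * dot b F).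
    by rewrite !dotE !crossE; ring.
  by rewrite aF bF !mulr0 subr0.
by apply: ord3P; apply: ord3P.
Qed.

(** The adjugate identity for the matrix with rows [a], [b], [c]. *)
Lemma cramer a b c j l :
  cross a b 0 j * c 0 l + cross b c 0 j * a 0 l + cross c a 0 j * b 0 l =
  (j == l)%:R * dot (cross a b) c.
Proof.
rewrite dotE !crossE; move: j l.
by apply: ord3P; apply: ord3P; rewrite !crossE /=; ring.
Qed.

Lemma dot_cross a b : dot (cross a b) b = 0.
Proof. by rewrite dotE !crossE; ring. Qed.

(** Serves for Koszul syzygies: when [a], [b] are the basis vectors of indices [l + 1], [l + 1 + 1],
    the factor is [F 0 l]. *)
Lemma cross_cross a b F :
  cross (cross a F) (cross b F) = dot (cross a b) F *: F.
Proof.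
by apply/rowP; apply: ord3P; rewrite !crossE mxE dotE !crossE; ring.
Qed.

Lemma cross_delta l : cross (delta_mx 0 (l + 1)) (delta_mx 0 (l + 1 + 1)) =
  delta_mx 0 l.
Proof.
apply/rowP; move: l; apply: ord3P; apply: ord3P;
  by rewrite crossE !mxE -!val_eqE /=; ring.
Qed.

Lemma dot_delta l F : dot (delta_mx 0 l) F = F 0 l.
Proof. by rewrite dotE !mxE; move: l; apply: ord3P; rewrite -!val_eqE /=; ring. Qed.

Lemma cross_combination a b x y z w :
  cross (x *: a + y *: b) (z *: a + w *: b) = (x * w - y * z) *: cross a b.
Proof. by apply/rowP; apply: ord3P; rewrite [RHS]mxE !crossE !mxE; ring. Qed.

Lemma dotDl a b F : dot (a + b) F = dot a F + dot b F.
Proof. by rewrite !dotE !mxE; ring. Qed.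

Lemma dotZl x a F : dot (x *: a) F = x * dot a F.
Proof. by rewrite !dotE !mxE; ring. Qed.

End CrossProduct.

(** [u] and [w] are the coprime cofactors of [a 0 l] and [b 0 l] for a nonzero [a 0 l]. The
    vanishing minors give [b 0 j * u = a 0 j * w], and coprimality yields [t] in each coordinate. *)
Lemma rank_one_factor (R : idomainType) (a b : 'rV[R]_3) :
    factorial R -> a != 0 -> cross a b = 0 ->
  exists t u w, a = u *: t /\ b = w *: t.
Proof.
move=> factR a0 ab0.
have abE i j : a 0 i * b 0 j = a 0 j * b 0 i.
  apply/subr0_eq; case: (cross_minor a b i j) => [//|[k]].
  by rewrite ab0 mxE oppr0 => -[].
have [l al] : exists l, a 0 l != 0 by apply/rV0Pn.
have [g [u [w [aE bE gP]]]] := coprime_cofactors factR (b 0 l) al.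
have g0 : g != 0 by apply: contraNneq al => g0; rewrite aE g0 mul0r.
have /boolp.choice[t tE] j : exists t, b 0 j = t * w /\ a 0 j = t * u.
  by apply: gP; apply: (mulfI g0); rewrite mulrCA -aE mulrC abE bE; ring.
exists (\row_j t j), u, w; split; apply/rowP => j; rewrite !mxE mulrC.
  by have [] := tE j.
by have [] := tE j.
Qed.

Section Span.

Variables (R : comNzRingType) (V : lmodType R) (m : nat) (g : 'I_m -> V).
Implicit Types (A : {set 'I_m}) (a b : V).

Definition spanned A a : Prop := exists c : 'I_m -> R, a = \sum_(i in A) c i *: g i.

Lemma spanned_gen A i : i \in A -> spanned A (g i).
Proof.
move=> iA; exists (fun j => (j == i)%:R).
rewrite (bigD1 i) //= eqxx scale1r big1 ?addr0 // => j /andP[_ /negbTE ->].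
exact: scale0r.
Qed.

Lemma spannedD A a b : spanned A a -> spanned A b -> spanned A (a + b).
Proof.
move=> [c ->] [e ->]; exists (fun i => c i + e i).
by rewrite -big_split /=; apply: eq_bigr => i _; rewrite scalerDl.
Qed.

Lemma spannedZ A x a : spanned A a -> spanned A (x *: a).
Proof.
move=> [c ->]; exists (fun i => x * c i).
by rewrite scaler_sumr; apply: eq_bigr => i _; rewrite scalerA.
Qed.

Lemma spanned_sum A (I : finType) (P : pred I) (v : I -> V) :
  (forall i, P i -> spanned A (v i)) -> spanned A (\sum_(i | P i) v i).
Proof.
move=> vP; elim/big_ind: _ => //; last exact: spannedD.
by exists (fun=> 0); rewrite big1 // => i _; rewrite scale0r.
Qed.

Lemma spanned2 i j a : i != j ->
  spanned [set i; j] a <-> exists x y, a = x *: g i + y *: g j.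
Proof.
move=> ij; split=> [[c ->]|[x [y ->]]].
  by exists (c i), (c j); rewrite big_setU1 ?inE //= big_set1.
by apply: spannedD; apply/spannedZ/spanned_gen; rewrite !inE eqxx ?orbT.
Qed.

End Span.

Section GradedNakayama.

Variables (K : fieldType) (m : nat).
Local Notation S := {mpoly K[3]}.
Variables (g : 'I_m -> 'rV[S]_3) (e : 'I_m -> nat).
Hypothesis ge : forall i, homog_triple (e i) (g i).

Lemma component_combination D (A : {set 'I_m}) (c : 'I_m -> S) :
  map_mx (pihomog mdeg D) (\sum_(i in A) c i *: g i) =
  \sum_(i in A) (if (e i <= D)%N then pihomog mdeg (D - e i) (c i) else 0) *: g i.
Proof.
apply/rowP => l; rewrite mxE !summxE linear_sum /=; apply: eq_bigr => i _.
by rewrite !mxE (pihomogM _ _ (ge i l)).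
Qed.

(** In degree [e j] only the constant term of [a] acts on [g j], and it is invertible. *)
Lemma graded_nakayama (A : {set 'I_m}) (a : S) j :
  a@_0%MM != 0 -> spanned g A (a *: g j) -> spanned g A (g j).
Proof.
move=> a0 [c /(congr1 (map_mx (pihomog mdeg (e j))))].
rewrite component_combination => H.
have -> : g j = ((a@_0%MM)^-1)%:MP *: map_mx (pihomog mdeg (e j)) (a *: g j).
  apply/rowP => l; rewrite !mxE (pihomogM _ _ (ge j l)) leqnn subnn pihomog0E.
  by rewrite mulrA -mpolyCM mulVf // mul1r.
by rewrite H; apply: spannedZ; exists (fun i => if (e i <= e j)%N then
  pihomog mdeg (e j - e i) (c i) else 0).
Qed.

End GradedNakayama.

(** * Syzygies of the gradient *)

Section LinearForm.

Variables (K : fieldType) (n : nat).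
Local Notation S := {mpoly K[n]}.
Variable h : S.
Hypotheses (h1 : h \is 1.-homog) (h0 : h != 0).

Lemma linear_form_dvdM (a b : S) : dvdr h (a * b) -> dvdr h a \/ dvdr h b.
Proof.
have [phi [phih hphi]] := linear_form_quotient h1 h0.
have kerP p : phi p = 0 -> dvdr h p.
  by move=> p0; have := hphi p; rewrite p0 subr0.
move=> [c /(congr1 phi)/eqP]; rewrite !rmorphM phih mulr0 mulf_eq0.
by case/orP => /eqP/kerP; [left | right].
Qed.

(* Modulo a linear form the polynomial ring is again factorial, so the kernel of
   a nonzero row [(u, v)] over the quotient is free of rank one. *)
Lemma linear_form_syzygies (u v : S) : ~ dvdr h u ->
  exists p q, dvdr h (u * p + v * q) /\
    forall a b, dvdr h (u * a + v * b) ->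
    exists t, dvdr h (a - t * p) /\ dvdr h (b - t * q).
Proof.
have [phi [phih hphi]] := linear_form_quotient h1 h0.
have kerP p : dvdr h p <-> phi p = 0.
  split=> [[c ->]|p0]; first by rewrite rmorphM phih mulr0.
  by have := hphi p; rewrite p0 subr0.
have phiphi p : phi (phi p) = phi p.
  by apply/esym/subr0_eq; rewrite -rmorphB; apply/kerP/hphi.
move=> /kerP/eqP phiu; have factS : factorial S := @mpoly_factorial K n.
have [g [u' [v' [uE vE gP]]]] := coprime_cofactors factS (phi v) phiu.
have g0 : g != 0 by apply: contraNneq phiu => g0; rewrite uE g0 mul0r.
exists v', (- u'); split=> [|a b].
  apply/kerP; rewrite rmorphD !rmorphM rmorphN -(phiphi u) -(phiphi v) uE vE.
  by rewrite !rmorphM; ring.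
move=> /kerP; rewrite rmorphD !rmorphM uE vE => abE.
have [|t [aE bE]] := gP (phi a) (- phi b).
  apply/subr0_eq/(mulfI g0); rewrite mulr0 -[RHS]abE; ring.
exists t; split.
  by rewrite -aE; apply: hphi.
by rewrite mulrN -bE opprK; apply: hphi.
Qed.

End LinearForm.

Section JacobianSyzygies.

(** Here [d] is the degree of the partial derivatives; the curve has degree [d.+1]. *)
Variables (K : fieldType) (d : nat).
Local Notation S := {mpoly K[3]}.
Variable f : S.
Hypotheses (charK : [pchar K] =i pred0) (fd : f \is d.+1.-homog).
Hypothesis fred : reduced f.

Let factS : factorial S := @mpoly_factorial K 3.

Definition gradient : 'rV[S]_3 := \row_i f^`M(i).
Local Notation F := gradient.

Lemma ARE (a : 'rV[S]_3) : a \in AR f <-> dot a F = 0.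
Proof.
rewrite inE /dot; under [\sum_(i < 3) a 0 i * F 0 i]eq_bigr do rewrite mxE.
by split=> [/eqP|->].
Qed.

Lemma AR_unscale (x : S) (a : 'rV[S]_3) : x != 0 -> x *: a \in AR f -> a \in AR f.
Proof.
move=> x0 /ARE; rewrite dotZl => /eqP; rewrite mulf_eq0 (negbTE x0) /=.
by move/eqP/ARE.
Qed.

Lemma gradient_neq0 : exists j, F 0 j != 0.
Proof.
apply: boolp.contrapT => H.
have f0 : f = 0.
  apply: (@mulfI _ (d.+1%:R)%:MP).
    by rewrite mpolyC_eq0 ((pcharf0P K).1 charK).
  rewrite mulr0 mul_mpolyC -(euler_identity fd) big1 // => i _.
  suff -> : f^`M(i) = 0 by rewrite mulr0.
  by apply/eqP/negP => fi; apply: H; exists i; rewrite mxE; apply/negP.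
have := fred (g := 0) (h := 0); rewrite f0 mulr0 unitr0 => /(_ erefl).
by [].
Qed.

Lemma gradient_dhomog j : F 0 j \is d.-homog.
Proof. by rewrite mxE; apply: mderiv_dhomog. Qed.

Lemma gradient_no_common_prime p : prime_elt p -> ~ forall j, dvdr p (F 0 j).
Proof.
move=> pp H; apply: (reduced_gradient charK fd fred pp) => i.
by have := H i; rewrite mxE.
Qed.

(** As [cross a b] is parallel to [F], the entry [F 0 j] divides every [cross a b 0 j * F 0 i]; the
    [F 0 i] have no common prime, so it divides [cross a b 0 j]. *)
Lemma cross_AR a b : a \in AR f -> b \in AR f -> exists h, cross a b = h *: F.
Proof.
move=> /ARE aF /ARE bF; have [j Fj] := gradient_neq0.
have E := cross_orthogonal aF bF.
have [h hE] : dvdr (F 0 j) (cross a b 0 j).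
  apply: (dvdr_of_no_common_prime factS gradient_no_common_prime Fj) => i.
  by exists (cross a b 0 i); rewrite E.
exists h; apply/rowP => l; rewrite [RHS]mxE; apply: (mulIf Fj).
by rewrite E hE; ring.
Qed.

(** The determinant in [cramer] is [x * dot F c], which vanishes; a nonzero entry of [F] then
    cancels. *)
Lemma cross_relation a b c x y z : c \in AR f ->
  cross a b = x *: F -> cross b c = y *: F -> cross c a = z *: F ->
  x *: c + y *: a + z *: b = 0.
Proof.
move=> /ARE cF abE bcE caE; have [j Fj] := gradient_neq0.
apply/rowP => l; apply: (mulfI Fj); have := cramer a b c j l.
have -> : dot (cross a b) c = 0.
  by rewrite abE dotZl -[RHS](mulr0 x) -cF; congr (_ * _); rewrite !dotE; ring.
rewrite mulr0 abE bcE caE !mxE => E.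
by rewrite mulr0 -[RHS]E; ring.
Qed.

Lemma cross_dhomog a b e1 e2 h : homog_triple e1 a -> homog_triple e2 b ->
  cross a b = h *: F -> h != 0 -> (d <= e1 + e2)%N /\ h \is (e1 + e2 - d).-homog.
Proof.
move=> ha hb abE h0; have [j Fj] := gradient_neq0.
have : cross a b 0 j \is (e1 + e2).-homog.
  by rewrite mxE; apply: rpredB; apply: dhomogM; [apply: ha|apply: hb|apply: ha|apply: hb].
rewrite abE mxE => hF; have := pihomog_dE hF.
rewrite (pihomogM _ _ (gradient_dhomog j)) => /(mulIf Fj).
case: ifP => [_ <-|_ hE]; first by split=> //; apply: pihomogP.
by rewrite -hE eqxx in h0.
Qed.

Lemma unit_of_dvd_gradient h : h != 0 -> (forall j, dvdr h (F 0 j)) ->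
  h \is a GRing.unit.
Proof.
move=> /factS pph hF; case: pph hF => // p c pp _ hF.
by case: (gradient_no_common_prime pp) => j; have [t ->] := hF j;
  exists (t * c); ring.
Qed.

(** * Minimal systems of homogeneous generators *)

Section MinimalGenerators.

Variables (m : nat) (g : 'I_m -> 'rV[S]_3) (e : 'I_m -> nat).
Hypotheses (gmin : minimal_generators f g).
Hypothesis (ge : forall i, homog_triple (e i) (g i)).

Lemma gen_AR i : g i \in AR f.
Proof. by have [[gAR _] _] := gmin; apply: gAR; rewrite inE. Qed.

Lemma spannedT a : a \in AR f -> exists c : 'I_m -> S, a = \sum_i c i *: g i.
Proof.
have [[_ gP] _] := gmin; move=> /gP[c ->]; exists c.
by apply: eq_bigl => i; rewrite inE.
Qed.

Lemma spanning_setT (A : {set 'I_m}) : (forall j, spanned g A (g j)) -> A = setT.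
Proof.
move=> AP; apply/eqP; rewrite eqEproper subsetT /=; apply/negP => Aproper.
have [_ /(_ A Aproper)[]] := gmin; split=> [i _|a /spannedT[c ->]].
  exact: gen_AR.
by apply: spanned_sum => i _; apply/spannedZ/AP.
Qed.

Lemma gen_not_spanned j : ~ spanned g [set~ j] (g j).
Proof.
move=> H; have /setP/(_ j) : [set~ j] = setT.
  apply: spanning_setT => k; have [->//|kj] := eqVneq k j.
  by apply: spanned_gen; rewrite !inE.
by rewrite !inE eqxx.
Qed.

(** Expanding [t] in the generators puts [(1 - u * c j) *: g j] in the span of the others. The
    factor has constant term 1, so [g j] would be redundant. *)
Lemma gen_not_multiple j (u : S) t : u@_0%MM = 0 -> t \in AR f -> g j <> u *: t.
Proof.
move=> u0 /spannedT[c ->] gE; apply: (@gen_not_spanned j).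
apply: (graded_nakayama ge (a := 1 - u * c j)).
  by rewrite rmorphB rmorphM rmorph1 /= u0 mul0r subr0 oner_eq0.
have -> : (1 - u * c j) *: g j = \sum_(k in [set~ j]) u *: (c k *: g k).
  rewrite scalerBl scale1r {1}gE (bigD1 j) //= scalerDr scalerA addrC addKr.
  by rewrite scaler_sumr; apply: eq_bigl => k; rewrite !inE.
by apply: spanned_sum => k kj; apply/spannedZ/spannedZ/spanned_gen.
Qed.

(** Otherwise both are multiples [u *: t], [w *: t] of one syzygy. If [u] has no constant term,
    [g i] contradicts [gen_not_multiple]; if it has one, [u *: g j = w *: g i] makes [g j]
    redundant. *)
Lemma gen_cross_neq0 i j : i != j -> cross (g i) (g j) != 0.
Proof.
move=> ij; apply/eqP => ij0.
have gi0 : g i != 0.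
  apply/eqP => gi0; apply: (@gen_not_multiple i 0 (g i)); rewrite ?mcoeff0 //.
    exact: gen_AR.
  by rewrite scale0r.
have [t [u [w [giE gjE]]]] := rank_one_factor factS gi0 ij0.
have u0 : u != 0 by apply: contraNneq gi0 => u0; rewrite giE u0 scale0r.
have tAR : t \in AR f by apply: AR_unscale u0 _; rewrite -giE gen_AR.
have [u00|u00] := eqVneq u@_0%MM 0; first exact: (@gen_not_multiple i u t).
apply: (@gen_not_spanned j); apply: (graded_nakayama ge u00).
have -> : u *: g j = w *: g i by rewrite giE gjE !scalerA mulrC.
by apply/spannedZ/spanned_gen; rewrite !inE.
Qed.

Lemma gen_cross i j : i != j -> exists h,
  [/\ cross (g i) (g j) = h *: F, h != 0, (d <= e i + e j)%N
    & h \is (e i + e j - d).-homog].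
Proof.
move=> ij; have [h hE] := cross_AR (gen_AR i) (gen_AR j).
have h0 : h != 0.
  by apply: contraNneq (gen_cross_neq0 ij) => h0; rewrite hE h0 scale0r.
by have [] := cross_dhomog (ge i) (ge j) hE h0; exists h.
Qed.

(** The factor [x] is a nonzero constant, so [cross_relation] can be solved for every [g k]. *)
Lemma two_generators i j : i != j -> (e i + e j)%N = d -> [set i; j] = setT.
Proof.
move=> ij eij; have [x [xE x0 _]] := gen_cross ij.
rewrite eij subnn => xhom; apply: spanning_setT => k.
have [y yE] := cross_AR (gen_AR j) (gen_AR k).
have [z zE] := cross_AR (gen_AR k) (gen_AR i).
apply: (graded_nakayama ge (a := x)).
  by apply: contraNneq x0 => x00; rewrite -(pihomog_dE xhom) pihomog0E x00.
apply/(spanned2 _ _ ij); exists (- y), (- z).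
have /eqP := cross_relation (gen_AR k) xE yE zE.
by rewrite -addrA addr_eq0 opprD !scaleNr => /eqP.
Qed.

Lemma low_degree_multiple i a k : (forall j, j != i -> (k < e j)%N) ->
  a \in AR f -> homog_triple k a -> exists c, a = c *: g i.
Proof.
move=> ltk /spannedT[c aE] ak.
have aE' : a = map_mx (pihomog mdeg k) (\sum_(j in setT) c j *: g j).
  apply/rowP => l; rewrite mxE; under eq_bigl do rewrite inE.
  by rewrite -aE pihomog_dE //; apply: ak.
rewrite aE' (component_combination ge) (bigD1 i) ?inE //= big1 ?addr0.
  by eexists.
by move=> j /andP[_ ji]; rewrite leqNgt ltk //= scale0r.
Qed.

Lemma low_degree_zero a k : (forall j, (k < e j)%N) ->
  a \in AR f -> homog_triple k a -> a = 0.
Proof.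
move=> ltk /spannedT[c aE] ak; apply/rowP => l.
rewrite -(pihomog_dE (ak l)) aE summxE linear_sum /= big1 ?mxE // => j _.
by rewrite mxE (pihomogM _ _ (ge j l)) leqNgt ltk mul0r.
Qed.

Lemma three_generators i j : i != j -> (e i + e j)%N = d.+1 -> (m <= 3)%N.
Proof.
move=> ij eij; have [x [xE x0 _]] := gen_cross ij.
rewrite eij subSn // subnn => xhom.
(* Were all coordinates divisible by the linear form [x], [g i] would be [x] times a syzygy. *)
have [l Nl] : exists l, ~ dvdr x (g i 0 l).
  apply: boolp.contrapT => H.
  have /boolp.choice[t tE] l : dvdr x (g i 0 l).
    by apply: boolp.contrapT => Nl; apply: H; exists l.
  have giE : g i = x *: \row_l t l.
    by apply/rowP => l; rewrite !mxE mulrC.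
  apply: (fun x00 tAR => @gen_not_multiple i x _ x00 tAR giE).
    by rewrite (dhomog_nemf_coeff xhom) //= mdeg0.
  by apply: AR_unscale x0 _; rewrite -giE gen_AR.
have [p [q [xpq pqP]]] := linear_form_syzygies xhom x0 (g j 0 l) Nl.
(* Modulo [x] the rows [g i] and [g j] are proportional, so a relation between them in coordinate
   [l] holds in all coordinates. *)
have minorP k : dvdr x (g i 0 l * g j 0 k - g i 0 k * g j 0 l).
  have [->|[o]] := cross_minor (g i) (g j) l k; first by exists 0; rewrite mul0r.
  have xo : dvdr x (cross (g i) (g j) 0 o).
    by exists (F 0 o); rewrite xE mxE mulrC.
  by case=> ->; [|apply: dvdr_opp].
have [r rE] : exists r, p *: g i + q *: g j = x *: r.
  have /boolp.choice[r rE] k : dvdr x (p * g i 0 k + q * g j 0 k).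
    have [||//] := @linear_form_dvdM _ _ x xhom x0 (g i 0 l)
                     (p * g i 0 k + q * g j 0 k).
      have -> : g i 0 l * (p * g i 0 k + q * g j 0 k) =
          (g i 0 l * p + g j 0 l * q) * g i 0 k +
          q * (g i 0 l * g j 0 k - g i 0 k * g j 0 l) by ring.
      by apply: dvdr_add; [apply: dvdr_mulr | apply: dvdr_mull].
    by [].
  by exists (\row_k r k); apply/rowP => k; rewrite !mxE rE mulrC.
have rAR : r \in AR f.
  apply: (AR_unscale x0); rewrite -rE; apply/ARE; rewrite dotDl !dotZl.
  by rewrite !(ARE _).1 ?gen_AR // !mulr0 addr0.
(* By [cross_relation] the pair [(y, z)] is a relation modulo [x], hence congruent to [t] times
   [(p, q)]; dividing by [x] expresses [g k]. The component [c.1.1] is the coefficient of [r]. *)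
have cyclic k : exists c : S * S * S, g k = c.1.1 *: r + c.1.2 *: g i + c.2 *: g j.
  have [y yE] := cross_AR (gen_AR j) (gen_AR k).
  have [z zE] := cross_AR (gen_AR k) (gen_AR i).
  have R0 o : x * g k 0 o + y * g i 0 o + z * g j 0 o = 0.
    by have /rowP/(_ o) := cross_relation (gen_AR k) xE yE zE; rewrite !mxE.
  have [|t [[y' y'E] [z' z'E]]] := pqP y z.
    by exists (- g k 0 l); apply: subr0_eq; rewrite -(R0 l); ring.
  exists (- t, - y', - z'); apply/rowP => o; apply: (mulfI x0).
  have E2 : p * g i 0 o + q * g j 0 o = x * r 0 o.
    by have /rowP/(_ o) := rE; rewrite !mxE.
  rewrite !mxE /=; move: (R0 o) E2.
  rewrite -[y](subrK (t * p)) -[z](subrK (t * q)) y'E z'E => E1 E2.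
  apply/subr0_eq.
  transitivity (x * g k 0 o + t * (x * r 0 o) + x * y' * g i 0 o + x * z' * g j 0 o).
    by ring.
  by rewrite -E2 -[RHS]E1; ring.
have [c cE] := boolp.choice cyclic.
have gE k s : g k 0 s = (c k).1.1 * r 0 s + (c k).1.2 * g i 0 s + (c k).2 * g j 0 s.
  by rewrite [in LHS]cE !mxE.
(* If some coefficient of [r] has a nonzero constant term, that [g k] replaces [r] as third
   generator. *)
have [[k Tk]|allT] := boolp.pselect (exists k, (c k).1.1@_0%MM != 0).
  have AT : [set i; j; k] = setT.
    apply: spanning_setT => o; apply: (graded_nakayama ge Tk).
    have -> : (c k).1.1 *: g o = (c o).1.1 *: g k
        + ((c k).1.1 * (c o).1.2 - (c o).1.1 * (c k).1.2) *: g i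
        + ((c k).1.1 * (c o).2 - (c o).1.1 * (c k).2) *: g j.
      by apply/rowP => s; rewrite !mxE (gE o) (gE k); ring.
    by do 2?[apply: spannedD]; apply/spannedZ/spanned_gen; rewrite !inE eqxx ?orbT.
  rewrite -[m]card_ord -cardsT -AT (leq_trans (leq_card_setU _ _)) //.
  by rewrite cards1 addn1 ltnS cards2; case: eqP.
have T0 k : (c k).1.1@_0%MM = 0.
  by apply/eqP/negP => Tk; apply: allT; exists k; apply/negP.
have [a aE] := spannedT rAR.
(* Otherwise expand [r] in the generators and these in [r], [g i], [g j]: then [w *: r] lies in the
   span of [g i] and [g j], and [w] has constant term 1. *)
pose w := 1 - \sum_k a k * (c k).1.1.
have w0 : w@_0%MM != 0.
  rewrite rmorphB rmorph1 rmorph_sum /= big1 ?subr0 ?oner_eq0 // => k _.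
  by rewrite rmorphM /= T0 mulr0.
have wr : spanned g [set i; j] (w *: r).
  have -> : w *: r = \sum_k a k *: ((c k).1.2 *: g i + (c k).2 *: g j).
    rewrite scalerBl scale1r {1}aE scaler_suml -sumrB.
    by apply: eq_bigr => k _; apply/rowP => s; rewrite !mxE (gE k); ring.
  apply: spanned_sum => k _; apply/spannedZ/spannedD;
    by apply/spannedZ/spanned_gen; rewrite !inE eqxx ?orbT.
have AT : [set i; j] = setT.
  apply: spanning_setT => k; apply: (graded_nakayama ge w0).
  have -> : w *: g k = (c k).1.1 *: (w *: r) + (w * (c k).1.2) *: g i
      + (w * (c k).2) *: g j.
    by apply/rowP => s; rewrite !mxE (gE k); ring.
  do 2?[apply: spannedD]; first exact: spannedZ.
    by apply/spannedZ/spanned_gen; rewrite !inE eqxx.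
  by apply/spannedZ/spanned_gen; rewrite !inE eqxx orbT.
by rewrite -[m]card_ord -cardsT -AT cards2; case: eqP.
Qed.


End MinimalGenerators.

Lemma two_generated_degree e1 e2 : exponents f [:: e1; e2] -> (e1 + e2 = d)%N.
Proof.
move=> [_ [g [gmin ge]]]; pose i0 : 'I_2 := ord0; pose i1 : 'I_2 := ord_max.
have [h [hE h0 dle hhom]] := gen_cross gmin ge (isT : i0 != i1).
have koszul_AR a : cross a F \in AR f by apply/ARE/dot_cross.
have AT : [set i0; i1] = setT.
  by apply/setP => i; rewrite !inE; case: i => [[|[|]]].
have gen2 a : a \in AR f -> exists x y, a = x *: g i0 + y *: g i1.
  move=> aAR; apply/(spanned2 _ _ (isT : i0 != i1)); rewrite AT.
  by have [[_ gP] _] := gmin; apply: gP.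
(* Two Koszul syzygies have cross product [F 0 l *: F]; both are combinations of the generators, so
   it is also a multiple of [h *: F]. *)
have hF l : dvdr h (F 0 l).
  have [x [y xyE]] := gen2 _ (koszul_AR (delta_mx 0 (l + 1))).
  have [z [w zwE]] := gen2 _ (koszul_AR (delta_mx 0 (l + 1 + 1))).
  have [j Fj] := gradient_neq0; exists (x * w - y * z); apply: (mulIf Fj).
  have /rowP/(_ j) := cross_cross (delta_mx 0 (l + 1)) (delta_mx 0 (l + 1 + 1)) F.
  rewrite cross_delta dot_delta xyE zwE cross_combination hE scalerA.
  by rewrite [X in X = _ -> _]mxE [X in _ = X -> _]mxE => ->.
have hC : h \is 0.-homog.
  have /mpoly_unitP[c _ ->] := unit_of_dvd_gradient h0 hF.
  by rewrite -[c]mulr1 mpolyCM mul_mpolyC; apply/rpredZ/dhomog1.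
(* Degree 0 only says that a truncated difference vanishes; [dle] supplies the other inequality. *)
have /eqP := dhomog_uniq h0 hhom hC; rewrite subn_eq0 => led.
by apply/eqP; rewrite eqn_leq led.
Qed.

(** Makes [d1 + d2] independent of the system. If [e1 < d1], the first generator of the other system
    is zero; if [e2 < d2], its first two are multiples of [g i0]. Either way their cross product
    vanishes. *)
Lemma exponents_leq d1 d2 ds e1 e2 es :
  exponents f [:: d1, d2 & ds] -> exponents f [:: e1, e2 & es] ->
  (d1 + d2 <= e1 + e2)%N.
Proof.
move=> [dsort [g [gmin ge]]] [/andP[e12 _] [k [kmin ke]]].
pose k0 : 'I_(size [:: e1, e2 & es]) := ord0.
pose k1 : 'I_(size [:: e1, e2 & es]) := lift ord0 ord0.
have k01 := gen_cross_neq0 kmin ke (isT : k0 != k1).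
have nth_leq := sorted_leq_nth leq_trans leqnn 0 dsort.
apply: leq_add; rewrite leqNgt; apply/negP => lt.
  have k00 : k k0 = 0.
    apply: (low_degree_zero gmin ge _ (gen_AR kmin k0) (ke k0)) => j.
    by apply: leq_trans lt _; apply: (nth_leq 0 j) => //; rewrite inE ltn_ord.
  case/eqP: k01; apply/rowP; apply: ord3P;
    by rewrite crossE k00 !mxE !mul0r subrr.
pose i0 : 'I_(size [:: d1, d2 & ds]) := ord0.
have geq j : j != i0 -> (d2 <= nth 0 [:: d1, d2 & ds] j)%N.
  rewrite -val_eqE -lt0n => j0.
  by apply: (nth_leq 1 j) => //; rewrite inE ltn_ord.
have [|x xE] := low_degree_multiple gmin ge (i := i0) _ (gen_AR kmin k0) (ke k0).
  by move=> j /geq; apply/leq_trans/(leq_ltn_trans e12 lt).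
have [|y yE] := low_degree_multiple gmin ge (i := i0) _ (gen_AR kmin k1) (ke k1).
  by move=> j /geq; apply: leq_trans lt.
case/eqP: k01; apply/rowP; apply: ord3P; rewrite crossE xE yE !mxE; ring.
Qed.

End JacobianSyzygies.

Theorem theorem2p3 (R : realType) (d : nat) (f : {mpoly R[i][3]})
    (hd : (3 <= d)%N) (hf : f \is d.-homog) (fred : reduced f)
    (d1 d2 : nat) (ds : seq nat) (hds : exponents f [:: d1, d2 & ds]) :
  (free_curve f <-> (d1 + d2 = d - 1)%N) /\
  (plus_one_generated d f <-> (d1 + d2 = d)%N).
Proof.
case: d hd hf => // d _ hf; rewrite subn1 /=.
have charC : [pchar R[i]] =i pred0 := Num.Theory.pchar_num _.
(* Both notions ask for some minimal system, which has to be compared with the given one. *)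
have same e1 e2 es : exponents f [:: e1, e2 & es] -> (d1 + d2 = e1 + e2)%N.
  move=> hes; apply/eqP; rewrite eqn_leq.
  by rewrite (exponents_leq hds hes) (exponents_leq hes hds).
have [_ [g [gmin ge]]] := hds.
pose i0 : 'I_(size [:: d1, d2 & ds]) := ord0.
pose i1 : 'I_(size [:: d1, d2 & ds]) := lift ord0 ord0.
split; split.
- move=> [[|e1 [|e2 [|//]]]] // _ he.
  by rewrite (same _ _ _ he) (two_generated_degree charC hf fred he).
- move=> dE; have AT := two_generators charC hf fred gmin ge (isT : i0 != i1) dE.
  have : #|[set: 'I_(size [:: d1, d2 & ds])]| = 2 by rewrite -AT cards2.
  rewrite cardsT card_ord /= => -[/size0nil dsE].
  by exists [:: d1; d2]; rewrite // -dsE.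
- by move=> [e1 [e2 [e3 [he <-]]]]; apply: same he.
(* At most three generators remain; exactly two would force [d1 + d2 = d], one less than assumed. *)
move=> dE; have := three_generators charC hf fred gmin ge (isT : i0 != i1) dE.
case: (ds) hds => [|d3 [|//]] // hd3 _; last by exists d1, d2, d3.
have /eqP := two_generated_degree charC hf fred hd3.
by rewrite dE -[X in _ == X]addn0 -addn1 eqn_add2l.
Qed.
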